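(* Let $L$ be an $n$-modular lattice, for some integer $n > 0$. Then $$M_3[\operatorname{Id} L] \cong \operatorname{Id} M_3[L].$$
   Context: For a lattice $L$, a triple $\langle x,y,z\rangle \in L^3$ is balanced if $x\wedge y = x\wedge z = y\wedge z$. $M_3[L]$ denotes the set of all balanced triples, regarded as a subposet of $L^3$ (componentwise order); for $n$-modular $L$ this poset is a lattice. Define lattice polynomials in the variables $x,y,z$ by $p_0=x$, $q_0=y$, $r_0=z$, and $p_{n+1}=p_n\vee(q_n\wedge r_n)$, $q_{n+1}=q_n\vee(p_n\wedge r_n)$, $r_{n+1}=r_n\vee(p_n\wedge q_n)$. For $n>0$, a lattice is $n$-modular if it satisfies the identity $p_n=p_{n+1}$. For a lattice $K$, $\operatorname{Id} K$ denotes the lattice of all (nonempty) ideals of $K$, ordered by inclusion. *)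

(* Defs.v *)
From HB Require Import structures.
From mathcomp Require Import all_boot all_order.
From mathcomp Require Import boolp classical_sets.

Set Implicit Arguments.
Unset Strict Implicit.
Unset Printing Implicit Defensive.

Import Order.Theory.
Local Open Scope classical_set_scope.
Local Open Scope order_scope.

Section Polynomials.
Context {d : Order.disp_t} {L : latticeType d}.
Implicit Types (x y z : L) (t u : L *p L *p L).

(* (p_k, q_k, r_k) |-> (p_(k+1), q_(k+1), r_(k+1)) *)
Definition pqr_step t : L *p L *p L :=
  let: (p, q, r) := t in
  (p `|` (q `&` r), q `|` (p `&` r), r `|` (p `&` q)).

Definition pqr (k : nat) t : L *p L *p L := iter k pqr_step t.

Definition p_ (k : nat) x y z : L := (pqr k (x, y, z)).1.1.
Definition q_ (k : nat) x y z : L := (pqr k (x, y, z)).1.2.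
Definition r_ (k : nat) x y z : L := (pqr k (x, y, z)).2.

Definition balanced t : bool :=
  let: (x, y, z) := t in (x `&` y == x `&` z) && (x `&` z == y `&` z).

Lemma pqrE k x y z : pqr k (x, y, z) = (p_ k x y z, q_ k x y z, r_ k x y z).
Proof. by rewrite /p_ /q_ /r_; case: pqr => [[]]. Qed.

Lemma le3E (x y z x' y' z' : L) :
  (((x, y, z) : L *p L *p L) <= (x', y', z')) = [&& x <= x', y <= y' & z <= z'].
Proof. by rewrite !leEprod /= andbA. Qed.

Lemma balancedP x y z : reflect
  [/\ y `&` z <= x, x `&` z <= y & x `&` y <= z] (balanced (x, y, z)).
Proof.
apply: (iffP andP) => [[/eqP e1 /eqP e2]|[h1 h2 h3]].
  by split; rewrite -?e2 -?e1 ?leIl ?leIr // e1 leIr.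
have e1 : x `&` y = x `&` z.
  by apply/le_anti; rewrite !lexI !leIl h2 h3.
split; apply/eqP => //; apply/le_anti.
by rewrite !lexI leIr h2 h1 leIr.
Qed.

Lemma le_pqr_step t : t <= pqr_step t.
Proof. by case: t => [[x y] z]; rewrite /pqr_step le3E !leUl. Qed.

Lemma le_pqr k t : t <= pqr k t.
Proof. by elim: k => //= k /le_trans; apply; exact: le_pqr_step. Qed.

Lemma pqr_step_mono t u : t <= u -> pqr_step t <= pqr_step u.
Proof.
case: t u => [[x y] z] [[x' y'] z']; rewrite /pqr_step !le3E => /and3P[hx hy hz].
by rewrite !leU2 ?leI2.
Qed.

Lemma pqr_mono k t u : t <= u -> pqr k t <= pqr k u.
Proof. by move=> h; elim: k => //= k; exact: pqr_step_mono. Qed.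

Lemma balanced_step t : balanced t = (pqr_step t == t).
Proof.
case: t => [[x y] z]; apply/balancedP/eqP => [[h1 h2 h3]|].
  by rewrite /pqr_step; congr (_, _, _); apply/join_idPl.
by case=> /join_idPl h1 /join_idPl h2 /join_idPl h3.
Qed.

Lemma pqr_balanced_le k t u : balanced u -> t <= u -> pqr k t <= u.
Proof.
rewrite balanced_step => /eqP bu h; elim: k => //= k /pqr_step_mono.
by rewrite bu.
Qed.

Lemma balancedI t u : balanced t -> balanced u -> balanced (t `&` u).
Proof.
case: t u => [[x y] z] [[x' y'] z'] /balancedP[h1 h2 h3] /balancedP[k1 k2 k3].
apply/balancedP; split; rewrite lexI.
- by rewrite (le_trans (leI2 (leIl _ _) (leIl _ _)) h1)
             (le_trans (leI2 (leIr _ _) (leIr _ _)) k1).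
- by rewrite (le_trans (leI2 (leIl _ _) (leIl _ _)) h2)
             (le_trans (leI2 (leIr _ _) (leIr _ _)) k2).
- by rewrite (le_trans (leI2 (leIl _ _) (leIl _ _)) h3)
             (le_trans (leI2 (leIr _ _) (leIr _ _)) k3).
Qed.

(* q_k and r_k are p_k after a transposition of the variables; hence the
   identity p_n = p_(n+1) gives q_n = q_(n+1) and r_n = r_(n+1) too. *)
Lemma q_swap k x y z : q_ k x y z = p_ k y x z.
Proof.
suff: pqr k (y, x, z) = (q_ k x y z, p_ k x y z, r_ k x y z).
  by move/(congr1 (fun t => t.1.1)) => /= <-.
elim: k => //= k ->; rewrite /p_ /q_ /r_ /=.
by case: (pqr k (x, y, z)) => [[p q] r] /=; rewrite (meetC q p).
Qed.

Lemma r_swap k x y z : r_ k x y z = p_ k z y x.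
Proof.
suff: pqr k (z, y, x) = (r_ k x y z, q_ k x y z, p_ k x y z).
  by move/(congr1 (fun t => t.1.1)) => /= <-.
elim: k => //= k ->; rewrite /p_ /q_ /r_ /=.
by case: (pqr k (x, y, z)) => [[p q] r] /=; rewrite (meetC q p) (meetC r p) (meetC r q).
Qed.

End Polynomials.

HB.mixin Record Lattice_isNModular (n : nat) d L of Order.Lattice d L := {
  p_stable : forall x y z : L, p_ n x y z = p_ n.+1 x y z
}.

#[short(type="nModularLatticeType")]
HB.structure Definition NModularLattice (n : nat) d :=
  { L of Order.Lattice d L & Lattice_isNModular n d L }.

Section M3.
Context {d : Order.disp_t}.
Variable L : latticeType d.

Record M3 := BalancedTriple {
  triple :> L *p L *p L;
  _ : balanced triple
}.

HB.instance Definition _ := [isSub for triple].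
HB.instance Definition _ := [Choice of M3 by <:].
HB.instance Definition _ := [SubChoice_isSubPOrder of M3 by <: with d].

Lemma M3_balanced (t : M3) : balanced t.
Proof. exact: valP. Qed.

Lemma leEM3 (t u : M3) : (t <= u) = (triple t <= triple u).
Proof. by []. Qed.

End M3.

Section M3Lattice.
Context {n : nat} {d : Order.disp_t}.
Variable L : nModularLatticeType n d.

Lemma pqr_balanced (t : L *p L *p L) : balanced (pqr n t).
Proof.
case: t => [[x y] z]; rewrite balanced_step; apply/eqP.
rewrite -[pqr_step _]/(pqr n.+1 (x, y, z)) !pqrE !q_swap !r_swap.
by congr (_, _, _); rewrite -p_stable.
Qed.

Definition M3_meet (t u : M3 L) : M3 L :=
  BalancedTriple (balancedI (M3_balanced t) (M3_balanced u)).

Definition M3_join (t u : M3 L) : M3 L :=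
  BalancedTriple (pqr_balanced (triple t `|` triple u)).

Fact M3_meetP (t u v : M3 L) : (t <= M3_meet u v) = (t <= u) && (t <= v).
Proof. by rewrite !leEM3 /= lexI. Qed.

Fact M3_joinP (t u v : M3 L) : (M3_join t u <= v) = (t <= v) && (u <= v).
Proof.
rewrite !leEM3 /= -leUx; apply/idP/idP => [|h].
  exact: (le_trans (le_pqr _ _)).
exact: pqr_balanced_le (M3_balanced v) h.
Qed.

HB.instance Definition _ :=
  Order.POrder_MeetJoin_isLattice.Build d (M3 L) M3_meetP M3_joinP.

End M3Lattice.

Section Ideals.
Context {d : Order.disp_t}.
Variable L : latticeType d.

Definition is_ideal (I : set L) : Prop :=
  [/\ I !=set0,
      forall x y, x <= y -> I y -> I x
    & forall x y, I x -> I y -> I (x `|` y)].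

Record ideal := Ideal {
  ideal_set :> set L;
  _ : `[< is_ideal ideal_set >]
}.

HB.instance Definition _ := [isSub for ideal_set].
HB.instance Definition _ := [Choice of ideal by <:].
HB.instance Definition _ := [SubChoice_isSubPOrder of ideal by <: with d].

Lemma idealP (I : ideal) : is_ideal I.
Proof. exact/asboolP/(valP I). Qed.

Lemma leEideal (I J : ideal) : (I <= J) = (I `<=` J)%classic :> Prop.
Proof. exact: subsetEset. Qed.

Definition join_set (I J : set L) : set L :=
  [set x | exists i j, [/\ I i, J j & x <= i `|` j]].

Fact ideal_meet_subproof (I J : ideal) : is_ideal (I `&` J)%classic.
Proof.
have [[i Ii] dI uI] := idealP I; have [[j Jj] dJ uJ] := idealP J; split.
- by exists (i `&` j); split; [apply: dI Ii|apply: dJ Jj]; rewrite ?leIl ?leIr.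
- by move=> x y xy [Iy Jy]; split; [apply: dI Iy|apply: dJ Jy].
- by move=> x y [Ix Jx] [Iy Jy]; split; [apply: uI|apply: uJ].
Qed.

Fact ideal_join_subproof (I J : ideal) : is_ideal (join_set I J).
Proof.
have [[i Ii] dI uI] := idealP I; have [[j Jj] dJ uJ] := idealP J; split.
- by exists i, i, j; split; rewrite ?leUl.
- by move=> x y xy [a [b [Ia Jb h]]]; exists a, b; split=> //; exact: le_trans h.
- move=> x y [a [b [Ia Jb h]]] [a' [b' [Ia' Jb' h']]].
  exists (a `|` a'), (b `|` b'); split; [exact: uI|exact: uJ|].
  by rewrite joinACA leU2.
Qed.

Definition ideal_meet (I J : ideal) : ideal :=
  Ideal (asboolT (ideal_meet_subproof I J)).
Definition ideal_join (I J : ideal) : ideal :=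
  Ideal (asboolT (ideal_join_subproof I J)).

Fact ideal_meetP (I J K : ideal) :
  (I <= ideal_meet J K) = (I <= J) && (I <= K).
Proof.
apply/idP/andP; rewrite !leEideal /=.
  by move=> h; split=> x /h[].
by move=> [h k] x Ix; split; [exact: h|exact: k].
Qed.

Fact ideal_joinP (I J K : ideal) :
  (ideal_join I J <= K) = (I <= K) && (J <= K).
Proof.
have [[i Ii] _ _] := idealP I; have [[j Jj] _ _] := idealP J.
have [_ dK uK] := idealP K.
apply/idP/andP; rewrite !leEideal /=.
  by move=> h; split=> x ?; apply: h; [exists x, j|exists i, x];
    split; rewrite ?leUl ?leUr.
by move=> [h k] x [a [b [Ia Jb hx]]]; apply: dK hx _; apply: uK;
  [exact: h|exact: k].
Qed.

HB.instance Definition _ :=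
  Order.POrder_MeetJoin_isLattice.Build d ideal ideal_meetP ideal_joinP.

Lemma mem_ideal_meet (I J : ideal) x :
  ideal_set (I `&` J) x <-> ideal_set I x /\ ideal_set J x.
Proof. by []. Qed.

Lemma mem_ideal_join (I J : ideal) x : ideal_set (I `|` J) x <->
  exists i j, [/\ ideal_set I i, ideal_set J j & x <= i `|` j].
Proof. by []. Qed.

Definition mem3 (t : ideal *p ideal *p ideal) (u : L *p L *p L) : Prop :=
  [/\ ideal_set t.1.1 u.1.1, ideal_set t.1.2 u.1.2 & ideal_set t.2 u.2].

Lemma mem3_step t u : mem3 t u -> mem3 (pqr_step t) (pqr_step u).
Proof.
have mj (I J K : ideal) x y z :
    ideal_set I x -> ideal_set J y -> ideal_set K z ->
    ideal_set (I `|` (J `&` K)) (x `|` (y `&` z)).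
  move=> Ix Jy Kz; apply/mem_ideal_join; exists x, (y `&` z); split=> //.
  have [_ dJ _] := idealP J; have [_ dK _] := idealP K.
  by apply/mem_ideal_meet; split;
    [apply: dJ Jy; exact: leIl|apply: dK Kz; exact: leIr].
by case: t u => [[I J] K] [[x y] z] [/= Ix Jy Kz]; split; exact: mj.
Qed.

Lemma mem3_pqr k t u : mem3 t u -> mem3 (pqr k t) (pqr k u).
Proof. by move=> h; elim: k => //= k; exact: mem3_step. Qed.

Lemma mem3_pqr_inv k t u :
  mem3 (pqr k t) u -> exists2 v, mem3 t v & u <= pqr k v.
Proof.
elim: k u => [|k IHk] [[x y] z]; first by exists (x, y, z).
rewrite /= ; case: (pqr k t) IHk => [[P Q] R] IHk.
move=> [[p [s [Pp [Qs Rs] xps]]] [q [s' [Qq [Ps' Rs'] yqs']]]].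
move=> [r [s'' [Rr [Ps'' Qs''] zrs'']]].
have [_ _ uP] := idealP P; have [_ _ uQ] := idealP Q.
have [_ _ uR] := idealP R.
have /IHk[v tv le_v] : mem3 (P, Q, R)
    (p `|` (s' `|` s''), q `|` (s `|` s''), r `|` (s `|` s')).
  by split=> /=; [apply: (uP)|apply: (uQ)|apply: (uR)] => //; [exact: uP|exact: uQ|exact: uR].
exists v => //; move: le_v; case: (pqr k v) => [[a b] c].
rewrite /pqr_step !le3E !leUx.
move=> /and3P[/and3P[pa s'a s''a] /and3P[qb sb s''b] /and3P[rc sc s'c]].
apply/and3P; split.
- by apply: (le_trans xps); apply: leU2 => //; rewrite lexI sb.
- by apply: (le_trans yqs'); apply: leU2 => //; rewrite lexI s'a.
- by apply: (le_trans zrs''); apply: leU2 => //; rewrite lexI s''a.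
Qed.

End Ideals.

Section IdealNModular.
Context {n : nat} {d : Order.disp_t}.
Variable L : nModularLatticeType n d.

Fact ideal_p_stable (I J K : ideal L) : p_ n I J K = p_ n.+1 I J K.
Proof.
apply/le_anti/andP; split.
  have := le_pqr_step (pqr n (I, J, K)).
  by rewrite -[pqr_step _]/(pqr n.+1 (I, J, K)) !pqrE le3E => /and3P[].
rewrite leEideal => x px.
have [[b Qb] _ _] := idealP (q_ n.+1 I J K).
have [[c Rc] _ _] := idealP (r_ n.+1 I J K).
have /mem3_pqr_inv[[[i j] k] ijk] : mem3 (pqr n.+1 (I, J, K)) (x, b, c) by [].
rewrite pqrE le3E => /and3P[xp _ _].
have [_ dp _] := idealP (p_ n I J K).
apply: dp (xp) _; rewrite -p_stable.
by have [] := mem3_pqr n ijk.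
Qed.

HB.instance Definition _ :=
  Lattice_isNModular.Build n d (ideal L) ideal_p_stable.

End IdealNModular.

(* Main.v *)
Require Import Defs.
From HB Require Import structures.
From mathcomp Require Import all_boot all_order.
From mathcomp Require Import boolp classical_sets.

(** A balanced triple of ideals (I, J, K) determines the ideal of M_3[L]
    consisting of the balanced triples in I x J x K ([box_ideal]), and an ideal
    A of M_3[L] determines the triple of the ideals generated by its three
    projections ([projections]).  These two maps are order preserving and
    mutually inverse, hence lattice isomorphisms.

    Everything rests on the closure u |-> pqr n u, which sends a triple of
    elements to the least balanced triple above it and so computes the joins
    of M_3[L].  A lattice polynomial evaluated at elements of I, J and K
    belongs to the same polynomial evaluated at I, J and K, and a balanced
    triple of ideals is a fixed point of the polynomials; so I x J x K is stable
    under the closure ([mem3_closure]).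
    This makes the box of (I, J, K) closed under the joins of M_3[L], and it
    makes that box cofinal in I x J x K, so that its projections give back
    I, J and K.  In the other direction, three elements of the projections of
    A lie below the coordinates of one element of A, because A is directed
    ([mem3_projections]); balancedness of the projections of A, and the
    equality of A with their box, both follow. *)

Set Implicit Arguments.
Unset Strict Implicit.
Unset Printing Implicit Defensive.

Import Order.Theory.
Local Open Scope classical_set_scope.
Local Open Scope order_scope.

Lemma le_iso_lmorphism {d1 d2 : Order.disp_t} {M : latticeType d1}
    {N : latticeType d2} (f : M -> N) (g : N -> M) :
  {homo f : x y / x <= y} -> {homo g : x y / x <= y} ->
  cancel f g -> cancel g f ->
  exists h : {lmorphism M -> N}, bijective h.
Proof.
move=> f_homo g_homo fK gK.
have fI : {morph f : x y / x `&` y}.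
  move=> x y; apply/le_anti; rewrite lexI !f_homo ?leIl ?leIr //=.
  rewrite -[X in X <= _]gK; apply: f_homo.
  by rewrite lexI -{2}(fK x) -{3}(fK y) !g_homo ?leIl ?leIr.
have fU : {morph f : x y / x `|` y}.
  move=> x y; apply/le_anti; rewrite leUx !f_homo ?leUl ?leUr //= andbT.
  rewrite -[X in _ <= X]gK; apply: f_homo.
  by rewrite leUx -{1}(fK x) -{2}(fK y) !g_homo ?leUl ?leUr.
pose ordF := Order.isOrderMorphism.Build _ _ _ _ f f_homo.
pose f_le : {omorphism M -> N} := HB.pack f ordF.
pose latF := Order.isLatticeMorphism.Build _ _ _ _ f_le fI fU.
pose h : {lmorphism M -> N} := HB.pack f ordF latF.
by exists h, g.
Qed.

Section LowerImage.
Context {d1 d2 : Order.disp_t} {M : latticeType d1} {N : latticeType d2}.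
Variables (c : M -> N) (c_homo : {homo c : u v / u <= v}).

Fact lower_image_subproof (A : ideal M) :
  is_ideal [set x | exists2 u, ideal_set A u & x <= c u].
Proof.
have [[a Aa] _ uA] := idealP A; split.
- by exists (c a), a.
- by move=> x y xy [u Au yu]; exists u => //; exact: le_trans yu.
- move=> x y [u Au xu] [v Av yv]; exists (u `|` v); first exact: uA.
  by rewrite leUx (le_trans xu) ?(le_trans yv) // c_homo ?leUl ?leUr.
Qed.

(** The ideal generated by the image of A: since c preserves order, the
    image is directed and its lower closure is already an ideal. *)
Definition lower_image (A : ideal M) : ideal N :=
  Ideal (asboolT (lower_image_subproof A)).

Lemma lower_image_homo : {homo lower_image : A B / A <= B}.
Proof.
by move=> A B; rewrite !leEideal => AB x [u Au xu]; exists u => //; exact: AB.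
Qed.

End LowerImage.

Section Mem3.
Context {d : Order.disp_t} {L : latticeType d}.
Implicit Types (t s : ideal L *p ideal L *p ideal L) (u v : L *p L *p L).

Lemma mem3_le t u v : u <= v -> mem3 t v -> mem3 t u.
Proof.
case: t u v => [[I J] K] [[x y] z] [[x' y'] z'].
rewrite le3E => /and3P[xx' yy' zz'] [/= Ix Jy Kz].
have [_ dI _] := idealP I; have [_ dJ _] := idealP J.
have [_ dK _] := idealP K.
by split; [exact: dI Ix|exact: dJ Jy|exact: dK Kz].
Qed.

Lemma mem3U t u v : mem3 t u -> mem3 t v -> mem3 t (u `|` v).
Proof.
case: t u v => [[I J] K] [[x y] z] [[x' y'] z'] [/= Ix Jy Kz] [/= Ix' Jy' Kz'].
have [_ _ uI] := idealP I; have [_ _ uJ] := idealP J.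
have [_ _ uK] := idealP K.
by split; [exact: uI|exact: uJ|exact: uK].
Qed.

Lemma mem3_mono t s u : t <= s -> mem3 t u -> mem3 s u.
Proof.
case: t s => [[I J] K] [[I' J'] K']; rewrite le3E => /and3P[].
rewrite !leEideal => II' JJ' KK' [*].
by split; [exact: II'|exact: JJ'|exact: KK'].
Qed.

Lemma mem3_nonempty t : exists u, mem3 t u.
Proof.
case: t => [[I J] K]; have [[i Ii] _ _] := idealP I.
by have [[j Jj] _ _] := idealP J; have [[k Kk] _ _] := idealP K;
  exists (i, j, k).
Qed.

(** The polynomials evaluated at elements of I, J, K take values in the same
    polynomials evaluated at I, J, K, which are again I, J, K: a balanced
    triple is a fixed point of the polynomial step. *)
Lemma mem3_closure k t u : balanced t -> mem3 t u -> mem3 t (pqr k u).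
Proof. by move=> bt /(mem3_pqr k); apply: mem3_mono; exact: pqr_balanced_le. Qed.

End Mem3.

Section Iso.
Context {n : nat} {d : Order.disp_t} {L : nModularLatticeType n d}.
Implicit Types (t s : M3 (ideal L)) (A B : ideal (M3 L)) (u v : M3 L).

Definition closure (w : L *p L *p L) : M3 L := BalancedTriple (pqr_balanced w).

Fact box_subproof t : is_ideal [set u | mem3 (triple t) (triple u)].
Proof.
have bt := M3_balanced t; split.
- by have [w tw] := mem3_nonempty (triple t); exists (closure w);
    exact: mem3_closure.
- by move=> u v uv; exact: mem3_le.
- by move=> u v tu tv; apply: mem3_closure => //; exact: mem3U.
Qed.

Definition box_ideal t : ideal (M3 L) := Ideal (asboolT (box_subproof t)).

Lemma box_ideal_homo : {homo box_ideal : t s / t <= s}.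
Proof.
by move=> t s; rewrite leEM3 leEideal => ts u /= tu; apply: (mem3_mono ts tu).
Qed.

Lemma coord1_homo : {homo (fun u => (triple u).1.1) : u v / u <= v}.
Proof.
by move=> [[[x y] z] bu] [[[x' y'] z'] bv]; rewrite leEM3 le3E => /and3P[].
Qed.

Lemma coord2_homo : {homo (fun u => (triple u).1.2) : u v / u <= v}.
Proof.
by move=> [[[x y] z] bu] [[[x' y'] z'] bv]; rewrite leEM3 le3E => /and3P[].
Qed.

Lemma coord3_homo : {homo (fun u => (triple u).2) : u v / u <= v}.
Proof.
by move=> [[[x y] z] bu] [[[x' y'] z'] bv]; rewrite leEM3 le3E => /and3P[].
Qed.

Definition projections A : ideal L *p ideal L *p ideal L :=
  (lower_image coord1_homo A, lower_image coord2_homo A,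
   lower_image coord3_homo A).

(** Three elements of A, each witnessing one coordinate, have their join in A;
    hence the elements of A are cofinal in the product of the projections. *)
Lemma mem3_projections A (w : L *p L *p L) :
  mem3 (projections A) w <-> exists2 u, ideal_set A u & w <= triple u.
Proof.
case: w => [[x y] z]; split.
  move=> [[u Au /= xu] [v Av /= yv] [s As /= zs]]; have [_ _ uA] := idealP A.
  exists (u `|` v `|` s); first by apply: (uA) => //; exact: uA.
  have [us vs ss] :
      [/\ u <= u `|` v `|` s, v <= u `|` v `|` s & s <= u `|` v `|` s].
    by split; rewrite ?leUr // (le_trans _ (leUl _ s)) ?leUl ?leUr.
  move: (coord1_homo us) (coord2_homo vs) (coord3_homo ss).
  case: (triple (_ `|` s)) => [[a b] c] /= ua vb sc.
  by rewrite le3E (le_trans xu) ?(le_trans yv) ?(le_trans zs).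
by move=> [[[[a b] c] bu] Au]; rewrite le3E => /and3P[xa yb zc];
  split; (eexists; first exact: Au).
Qed.

(** An element of the meet of two projections lies below two coordinates of
    one element of A, hence below the third one. *)
Lemma projections_balanced A : balanced (projections A).
Proof.
have [[[i j] k] [Ii Jj Kk]] := mem3_nonempty (projections A).
apply/balancedP; split; rewrite leEideal => m [m1 m2].
- have /mem3_projections[u Au] : mem3 (projections A) (i, m, m) by [].
  case: u Au => [[[a b] c] bu] Au; rewrite le3E => /and3P[_ mb mc].
  have [h _ _] := balancedP _ _ _ bu.
  by exists (BalancedTriple bu) => //=; rewrite (le_trans _ h) // lexI mb.
- have /mem3_projections[u Au] : mem3 (projections A) (m, j, m) by [].
  case: u Au => [[[a b] c] bu] Au; rewrite le3E => /and3P[ma _ mc].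
  have [_ h _] := balancedP _ _ _ bu.
  by exists (BalancedTriple bu) => //=; rewrite (le_trans _ h) // lexI ma.
- have /mem3_projections[u Au] : mem3 (projections A) (m, m, k) by [].
  case: u Au => [[[a b] c] bu] Au; rewrite le3E => /and3P[ma mb _].
  have [_ _ h] := balancedP _ _ _ bu.
  by exists (BalancedTriple bu) => //=; rewrite (le_trans _ h) // lexI ma.
Qed.

Definition M3_projections A : M3 (ideal L) :=
  BalancedTriple (projections_balanced A).

Lemma M3_projections_homo : {homo M3_projections : A B / A <= B}.
Proof. by move=> A B AB; rewrite leEM3 /= le3E !lower_image_homo. Qed.

(** An element of A is its own witness; conversely a member of the box lies
    below an element of A, and A is a lower set. *)
Lemma M3_projectionsK : cancel M3_projections box_ideal.
Proof.
move=> A; have [_ dA _] := idealP A.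
apply/le_anti/andP; split; rewrite leEideal => u.
  by move=> /mem3_projections[v Av uv]; exact: dA Av.
by move=> Au; apply/mem3_projections; exists u.
Qed.

(** Each element of I, completed arbitrarily by elements of J and K, lies below
    the first coordinate of a closure, which is a member of the box; likewise
    for J and K. *)
Lemma box_idealK : cancel box_ideal M3_projections.
Proof.
move=> t; apply/le_anti/andP; split; rewrite leEM3.
  case: t => [[[I J] K] bt]; rewrite le3E; apply/and3P.
  have [_ dI _] := idealP I; have [_ dJ _] := idealP J.
  have [_ dK _] := idealP K.
  by split; rewrite leEideal => x [u [/= Iu Ju Ku] xu];
    [exact: dI Iu|exact: dJ Ju|exact: dK Ku].
have sub w : mem3 (triple t) w -> mem3 (projections (box_ideal t)) w.
  move=> tw; apply/mem3_projections; exists (closure w); last exact: le_pqr.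
  exact/mem3_closure/tw/M3_balanced.
have [[[i j] k] /=] := mem3_nonempty (triple t).
case: (triple t) sub => [[I J] K] sub [/= Ii Jj Kk].
rewrite le3E; apply/and3P; split; rewrite leEideal => x tx.
- by have [] : mem3 (projections (box_ideal t)) (x, j, k) by exact: sub.
- by have [] : mem3 (projections (box_ideal t)) (i, x, k) by exact: sub.
- by have [] : mem3 (projections (box_ideal t)) (i, j, x) by exact: sub.
Qed.

End Iso.

Theorem proposition6p8 (n : nat) (n_gt0 : (0 < n)%N) (d : Order.disp_t)
    (L : nModularLatticeType n d) :
  exists f : {lmorphism M3 (ideal L) -> ideal (M3 L)}, bijective f.
Proof.
exact: le_iso_lmorphism box_ideal_homo M3_projections_homo
  box_idealK M3_projectionsK.
Qed.
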